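(* Let $h:\mathbb R^n\to\mathbb R\cup\{\infty\}$ be a Legendre kernel, let $f:\mathbb R^n\to\mathbb R\cup\{\infty\}$ be $L_f$-smooth relative to $h$, let $g:\mathbb R^n\to\mathbb R\cup\{\infty\}$ be proper and lower semicontinuous, and let $\varphi=f+g$. Then for every $\gamma\in(0,1/L_f)$ the function $\hat h:=\frac{h}{\gamma}-f$ (with the convention $\infty-\infty=\infty$) is a Legendre kernel. Moreover, $$\varphi(z)+\mathrm D_{\hat h}(z,x)=f(x)+\langle\nabla f(x),z-x\rangle+g(z)+\tfrac1\gamma \mathrm D_h(z,x)$$ holds for every $(z,x)\in\mathbb R^n\times\operatorname{int}\operatorname{dom}h$, and in particular, for $x\in\operatorname{int}\operatorname{dom}h$, $$T_\gamma(x)=\operatorname{prox}_{\varphi}^{\hat h}(x)=\operatorname{prox}_{\gamma\varphi}^{h-\gamma f}(x)\qquad\text{and}\qquad \Phi_\gamma(x)=\varphi^{\hat h}(x).$$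
   Context: A Legendre kernel is a proper, lsc, convex function $h:\mathbb R^n\to\mathbb R\cup\{\infty\}$ with $\operatorname{int}\operatorname{dom}h\ne\emptyset$, $h\in\mathcal C^1(\operatorname{int}\operatorname{dom}h)$, that is strictly convex, essentially smooth ($\|\nabla h(x_k)\|\to\infty$ for every sequence in $\operatorname{int}\operatorname{dom}h$ converging to a boundary point of $\operatorname{dom}h$), and $1$-coercive ($\lim_{\|x\|\to\infty}h(x)/\|x\|=\infty$). Bregman distance: $\mathrm D_h(x,y)=h(x)-h(y)-\langle\nabla h(y),x-y\rangle$ if $y\in\operatorname{int}\operatorname{dom}h$, and $\infty$ otherwise. A proper lsc $f$ is $L_f$-smooth relative to $h$ ($L_f\ge0$) if $\operatorname{dom}f\supseteq\operatorname{dom}h$ and $L_fh\pm f$ are convex on $\operatorname{int}\operatorname{dom}h$ (this implies $f\in\mathcal C^1(\operatorname{int}\operatorname{dom} h)$); $1/L_f:=\infty$ if $L_f=0$. Bregman proximal map and Bregman-Moreau envelope of $\varphi$ with kernel $\hat h$ and stepsize $\gamma>0$: $\operatorname{prox}_{\gamma\varphi}^{\hat h}(x)=\operatorname*{argmin}_{z}\{\varphi(z)+\frac1\gamma \mathrm D_{\hat h}(z,x)\}$ and $\varphi^{\hat h/\gamma}(x)=\inf_z\{\varphi(z)+\frac1\gamma \mathrm D_{\hat h}(z,x)\}$ (for $\gamma=1$: $\operatorname{prox}^{\hat h}_\varphi$, $\varphi^{\hat h}$). Bregman forward-backward map and envelope: $T_\gamma(x)=\operatorname*{argmin}_z\{f(x)+\langle\nabla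 f(x),z-x\rangle+g(z)+\frac1\gamma \mathrm D_h(z,x)\}$, and $\Phi_\gamma(x)$ is the infimum of the same expression over $z\in\mathbb R^n$.
   Formalization: The claim that ĥ is a Legendre kernel is stated assuming L_f h ± f convex on all of dom h, not only on int dom h; otherwise f may jump at the boundary and ĥ fail to be lsc (h(x) = x log x + (1−x) log(1−x) on [0,1], f = 0 except f(0) = −5). *)

(* Defs.v *)
From HB Require Import structures.
From mathcomp Require Import all_boot all_order all_algebra.
From mathcomp Require Import all_classical all_reals all_analysis.
Set Implicit Arguments.
Unset Strict Implicit.
Unset Printing Implicit Defensive.
Import Order.TTheory GRing.Theory Num.Theory.
Import numFieldNormedType.Exports.
Local Open Scope classical_set_scope.
Local Open Scope ring_scope.

Section Defs.
Context {R : realType} {n : nat}.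
Implicit Types (x y z : 'rV[R]_n) (f g h phi : 'rV[R]_n -> \bar R).

Definition inner x y : R := \sum_(i < n) x 0 i * y 0 i.

(* The library norm on 'rV[R]_n is the sup norm; it induces the same topology. *)
Definition enorm x : R := Num.sqrt (inner x x).

Definition edom f : set 'rV[R]_n := [set x | (f x < +oo)%E].

(* [proper_fun] also records that f takes its values in R U {+oo}. *)
Definition proper_fun f := (forall x, f x != -oo%E) /\ (exists x, edom f x).

(* For f without the value -oo, the sums below are never +oo - oo. *)
Definition convex_on (A : set 'rV[R]_n) f :=
  forall x y (t : R), A x -> A y -> 0 < t < 1 ->
    A (t *: x + (1 - t) *: y) /\
    (f (t *: x + (1 - t) *: y)%R <= t%:E * f x + (1 - t)%:E * f y)%E.

Definition strictly_convex f :=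
  forall x y (t : R), edom f x -> edom f y -> x != y -> 0 < t < 1 ->
    (f (t *: x + (1 - t) *: y)%R < t%:E * f x + (1 - t)%:E * f y)%E.

(* Only meaningful at points of the interior of [edom f], where [fine \o f]
   locally agrees with f. *)
Definition grad f x : 'rV[R]_n :=
  \row_(i < n) 'D_(delta_mx 0 i) (fine \o f : 'rV[R]_n -> R^o) x.

Definition C1_on (A : set 'rV[R]_n) f :=
  (forall x, A x -> differentiable (fine \o f : 'rV[R]_n -> R^o) x) /\
  (forall x, A x -> {for x, continuous (grad f)}).

Definition essentially_smooth h :=
  forall (u : nat -> 'rV[R]_n) x,
    (forall k, (edom h)° (u k)) ->
    (closure (edom h) `\` (edom h)°) x ->
    u @ \oo --> x ->
    enorm (grad h (u k)) @[k --> \oo] --> +oo.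

Definition one_coercive h :=
  forall M : R, exists r : R, forall x, r < enorm x ->
    (M%:E <= h x / (enorm x)%:E)%E.

Definition legendre h :=
  [/\ proper_fun h, lower_semicontinuous h & convex_on setT h] /\
  [/\ (edom h)° !=set0, C1_on (edom h)° h, strictly_convex h,
      essentially_smooth h & one_coercive h].

Definition bregman h x y : \bar R :=
  if `[< (edom h)° y >] then (h x - h y - (inner (grad h y) (x - y)%R)%:E)%E
  else +oo%E.

Definition rel_smooth (L : R) h f :=
  [/\ proper_fun f, lower_semicontinuous f & edom h `<=` edom f] /\
  [/\ 0 <= L,
      convex_on (edom h)° (fun x => L%:E * h x + f x)%E &
      convex_on (edom h)° (fun x => L%:E * h x - f x)%E].

Definition argmin (F : 'rV[R]_n -> \bar R) : set 'rV[R]_n :=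
  [set z | forall w, (F z <= F w)%E].

Definition prox h (gamma : R) phi x : set 'rV[R]_n :=
  argmin (fun z => phi z + gamma^-1%:E * bregman h z x)%E.

Definition envelope h (gamma : R) phi x : \bar R :=
  ereal_inf (range (fun z => phi z + gamma^-1%:E * bregman h z x)%E).

Definition fb_model f g h (gamma : R) x z : \bar R :=
  (f x + (inner (grad f x) (z - x)%R)%:E + g z + gamma^-1%:E * bregman h z x)%E.

Definition fb_map f g h (gamma : R) x : set 'rV[R]_n :=
  argmin (fb_model f g h gamma x).

Definition fb_envelope f g h (gamma : R) x : \bar R :=
  ereal_inf (range (fb_model f g h gamma x)).

End Defs.

(* Main.v *)
(** Write V = L h - f, so that hhat = (1/gamma - L) h + V with 1/gamma - L > 0:
    convexity, strict convexity and 1-coercivity of hhat come from h, because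
    the convex V has an affine minorant.  Differentiability of f: two convex
    functions with differentiable sum are differentiable, and gradients of
    differentiable convex functions are continuous.

    Lower semicontinuity of hhat at x in dom h: with p = t x0 + (1 - t) x and
    x0 interior, the affine minorant of hhat at p has at x a value tending to
    at least hhat x as t -> 0; here L h + f is convex up to the boundary and h
    is lower semicontinuous.  Off dom h, h tends to +oo and V is locally
    bounded below.

    Essential smoothness: if grad hhat stayed bounded along interior points
    tending to a boundary point x, then x would be in dom h and hhat would have
    a finite slope at x towards x0, hence so would h, V having slopes bounded
    above; but then grad h would be bounded along the segment from x0 to x. *)
Require Import Defs.
From HB Require Import structures.
From mathcomp Require Import all_boot all_order all_algebra.
From mathcomp Require Import all_classical all_reals all_analysis.
From mathcomp Require Import ring lra.
Set Implicit Arguments.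
Unset Strict Implicit.
Unset Printing Implicit Defensive.
Import Order.TTheory GRing.Theory Num.Theory.
Import numFieldNormedType.Exports.
Local Open Scope classical_set_scope.
Local Open Scope ring_scope.

(** * Inner product, coordinate bounds and the l1 norm *)

Section Inner.
Context {R : realType} {n : nat}.
Implicit Types (x y z p : 'rV[R]_n) (a : R).

Lemma innerC x y : inner x y = inner y x.
Proof. by apply: eq_bigr => i _; rewrite mulrC. Qed.

Lemma innerDr p x y : inner p (x + y) = inner p x + inner p y.
Proof. by rewrite -big_split; apply: eq_bigr => i _; rewrite mxE mulrDr. Qed.

Lemma innerZr p a x : inner p (a *: x) = a * inner p x.
Proof. by rewrite mulr_sumr; apply: eq_bigr => i _; rewrite mxE mulrCA. Qed.

Lemma innerNr p x : inner p (- x) = - inner p x.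
Proof. by rewrite -scaleN1r innerZr mulN1r. Qed.

Lemma innerBr p x y : inner p (x - y) = inner p x - inner p y.
Proof. by rewrite innerDr innerNr. Qed.

Lemma innerDl p x y : inner (x + y) p = inner x p + inner y p.
Proof. by rewrite innerC innerDr !(innerC p). Qed.

Lemma innerZl p a x : inner (a *: x) p = a * inner x p.
Proof. by rewrite innerC innerZr innerC. Qed.

Lemma innerBl p x y : inner (x - y) p = inner x p - inner y p.
Proof. by rewrite innerC innerBr !(innerC p). Qed.

Lemma inner_delta p i : inner p (delta_mx 0 i) = p 0 i.
Proof.
rewrite /inner (bigD1 i)//= mxE !eqxx mulr1 big1 ?addr0// => j ji.
by rewrite mxE (negbTE ji) andbF mulr0.
Qed.

Fact inner_linear p : linear (inner p : 'rV[R]_n -> R).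
Proof. by move=> a x y; rewrite innerDr innerZr. Qed.

HB.instance Definition _ p :=
  GRing.isLinear.Build R 'rV[R]_n R _ (inner p) (inner_linear p).

Lemma inner_continuous p : continuous (inner p : 'rV[R]_n -> R).
Proof.
move=> x; rewrite /inner.
apply: (@cvg_big R^o _ +%R);
  [exact: (@add_continuous R^o)|exact: nbhs_filter|move=> i _].
apply: (cvg_comp (fun y : 'rV[R]_n => y 0 i) (fun r : R => p 0 i * r : R^o)).
  exact: coord_continuous.
exact: mulrl_continuous.
Qed.

Lemma coord_le_norm x i : `|x 0 i| <= `|x|.
Proof.
rewrite [leRHS]mx_normrE.
exact: (@le_bigmax _ _ _ 0 (fun ij : 'I_1 * 'I_n => `|x ij.1 ij.2|) (0, i)).
Qed.

(** The l1 norm takes the place of Cauchy-Schwarz: it dominates [enorm], and paired with a bound on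
    coordinates it bounds an inner product. *)
Definition norm1 x : R := \sum_(i < n) `|x 0 i|.

Lemma norm1_ge0 x : 0 <= norm1 x.
Proof. exact: sumr_ge0. Qed.

Lemma norm1Z a x : norm1 (a *: x) = `|a| * norm1 x.
Proof. by rewrite mulr_sumr; apply: eq_bigr => i _; rewrite mxE normrM. Qed.

Lemma norm1_continuous : continuous norm1.
Proof.
move=> x; rewrite /norm1.
apply: (@cvg_big R^o _ +%R);
  [exact: (@add_continuous R^o)|exact: nbhs_filter|move=> i _].
apply: (cvg_comp (fun y : 'rV[R]_n => y 0 i) (fun r : R => `|r| : R^o)).
  exact: coord_continuous.
exact: (@norm_continuous R R^o).
Qed.

Lemma coord_le_enorm x i : `|x 0 i| <= enorm x.
Proof.
rewrite -sqrtr_sqr ler_wsqrtr// expr2 /inner (bigD1 i)//= lerDl.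
by apply: sumr_ge0 => j _; rewrite -expr2 sqr_ge0.
Qed.

Lemma enorm_ge0 x : 0 <= enorm x. Proof. exact: sqrtr_ge0. Qed.

Lemma enorm_le_norm1 x : enorm x <= norm1 x.
Proof.
rewrite -[leRHS]ger0_norm ?norm1_ge0// -sqrtr_sqr ler_wsqrtr// expr2 mulr_suml.
apply: ler_sum => i _; apply: le_trans (ler_norm _) _; rewrite normrM.
rewrite ler_wpM2l// /norm1 (bigD1 i)//= lerDl; exact: sumr_ge0.
Qed.

Lemma normr_inner_le p x (C : R) :
  (forall i, `|p 0 i| <= C) -> `|inner p x| <= C * norm1 x.
Proof.
move=> pC; apply: le_trans (ler_norm_sum _ _ _) _; rewrite mulr_sumr.
by apply: ler_sum => i _; rewrite normrM ler_wpM2r.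
Qed.

Lemma normr_inner_enorm p x : `|inner p x| <= norm1 p * enorm x.
Proof.
rewrite innerC mulrC; apply: normr_inner_le => i; exact: coord_le_enorm.
Qed.

End Inner.

(** * Gradients of real functions and first-order expansions *)

Section Gradient.
Context {R : realType} {n : nat}.
Implicit Types (x y z p : 'rV[R]_n) (K : 'rV[R]_n -> R).

(** Real-valued counterpart of [grad]: [grad k] unfolds to [gradient (fine \o k)]. *)
Definition gradient K x : 'rV[R]_n := \row_(i < n) 'D_(delta_mx 0 i) K x.

Lemma derive_gradient K x v : differentiable K x ->
  'D_v K x = inner (gradient K x) v.
Proof.
move=> dK; rewrite deriveE// [v in LHS]row_sum_delta linear_sum.
apply: eq_bigr => i _; rewrite linearZ mxE deriveE//.
by rewrite mulrC.
Qed.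

Lemma diff_of_expansion (V W : normedModType R) (f : V -> W)
    (df : {linear V -> W}) (x : V) : continuous df ->
  (forall e : R, 0 < e ->
     \forall w \near (0 : V), `|f (x + w) - f x - df w| <= e * `|w|) ->
  differentiable f x /\ 'd f x = df :> (V -> W).
Proof.
move=> dfc fdf.
have ex : f \o shift x = cst (f x) + df +o_ 0 id.
  apply/eqaddoP => e e0; apply: filterS (fdf e e0) => w /=.
  by rewrite opprD !fctE addrA [w + x]addrC.
have dE := diff_unique dfc ex.
by split=> //; apply/diff_locallyP; rewrite dE.
Qed.

Lemma expansion_of_diff (V W : normedModType R) (f : V -> W) (x : V) :
  differentiable f x -> forall e : R, 0 < e ->
  \forall w \near (0 : V), `|f (x + w) - f x - 'd f x w| <= e * `|w|.
Proof.
move=> df e e0; have /diff_locallyP[_ /eqaddoP/(_ e e0)] := df.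
by apply: filterS => w /=; rewrite opprD !fctE addrA [w + x]addrC.
Qed.

Lemma differentiable_of_expansion K x p :
  (forall e : R, 0 < e ->
     \forall w \near (0 : 'rV[R]_n), `|K (x + w) - K x - inner p w| <= e * `|w|) ->
  differentiable K x /\ gradient K x = p.
Proof.
move=> Kp.
have [dK dE] := diff_of_expansion (df := inner p) (@inner_continuous _ _ p) Kp.
split=> //; apply/rowP => i; rewrite mxE deriveE// dE.
exact: inner_delta.
Qed.

Lemma gradient_expansion K x : differentiable K x ->
  forall e : R, 0 < e ->
    \forall w \near (0 : 'rV[R]_n),
      `|K (x + w) - K x - inner (gradient K x) w| <= e * `|w|.
Proof.
move=> dK e e0; apply: filterS (expansion_of_diff dK e0) => w.
by rewrite -derive_gradient// deriveE.
Qed.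

(** Gradients are local. This matters because an extended-valued function and its real
    representative agree only on the domain. *)
Lemma near_eq_gradient K K' x :
  (\forall y \near x, K y = K' y) -> differentiable K x ->
  differentiable K' x /\ gradient K' x = gradient K x.
Proof.
move=> KK' dK; apply: differentiable_of_expansion => e e0.
have Kx := nbhs_singleton KK'.
have /nbhs0P KK'0 := KK'.
apply: filterS2 KK'0 (gradient_expansion dK e0) => w Ew.
by rewrite Ew Kx.
Qed.

Lemma gradientD K K' x : differentiable K x -> differentiable K' x ->
  gradient (K \+ K') x = gradient K x + gradient K' x.
Proof.
by move=> dK dK'; apply/rowP => i; rewrite !mxE deriveD//; exact: diff_derivable.
Qed.

Lemma gradientB K K' x : differentiable K x -> differentiable K' x ->
  gradient (K \- K') x = gradient K x - gradient K' x.
Proof.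
by move=> dK dK'; apply/rowP => i; rewrite !mxE deriveB//; exact: diff_derivable.
Qed.

Lemma gradientZ (a : R) K x : differentiable K x ->
  gradient (fun y => a * K y) x = a *: gradient K x.
Proof.
by move=> dK; apply/rowP => i; rewrite !mxE (@deriveZ _ _ _ K)//; exact: diff_derivable.
Qed.

End Gradient.

(** * Tangent inequality and differentiability of convex summands *)

Section Convex.
Context {R : realType} {n : nat}.
Implicit Types (x y z p w : 'rV[R]_n) (u v K : 'rV[R]_n -> R)
  (A D : set 'rV[R]_n).

Definition real_convex_on D K := forall x y (t : R), D x -> D y -> 0 < t < 1 ->
  D (t *: x + (1 - t) *: y) /\
  K (t *: x + (1 - t) *: y) <= t * K x + (1 - t) * K y.

Lemma near0_ball (P : R -> Prop) : (\forall t \near 0, P t) ->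
  exists2 d : R, 0 < d & forall t, `|t| < d -> P t.
Proof.
move=> /nbhs_ballP[d /= d0 dP]; exists d => // t td; apply: dP.
by rewrite -ball_normE /= sub0r normrN.
Qed.

Lemma near0_gt0 (P : R -> Prop) (d : R) : 0 < d ->
  (\forall t \near 0, P t) -> exists2 t, 0 < t < d & P t.
Proof.
move=> d0 /near0_ball[e e0 eP].
have m0 : 0 < Num.min d e by rewrite lt_min d0 e0.
exists (Num.min d e / 2).
  by rewrite divr_gt0//= (lt_le_trans (_ : _ < Num.min d e))// ?ge_min ?lexx//
    ltr_pdivrMr// ltr_pMr// ltr1n.
apply: eP; rewrite ger0_norm ?divr_ge0 ?(ltW m0)//.
by rewrite (lt_le_trans (_ : _ < Num.min d e))// ?ge_min ?lexx ?orbT//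
    ltr_pdivrMr// ltr_pMr// ltr1n.
Qed.

(** Convexity bounds [K (x + t (y - x)) - K x] by [t (K y - K x)]; the expansion at [x] bounds it
    below up to [e t]. Divide by a small [t] and let [e] vanish. *)
Lemma gradient_ineq D K x y : real_convex_on D K -> differentiable K x ->
  D x -> D y -> K x + inner (gradient K x) (y - x) <= K y.
Proof.
move=> cK dK Dx Dy; apply/ler_addgt0Pr => e e0.
(* Adding 1 keeps the divisor positive when [y = x]. *)
have N0 : 0 < `|y - x| + 1 by rewrite ltr_wpDl.
have e'0 : 0 < e / (`|y - x| + 1) by rewrite divr_gt0.
have /near0_gt0 := near0Z (y - x) (gradient_expansion dK e'0).
move=> /(_ 1 ltr01)[t /andP[t0 t1]]; rewrite innerZr normrZ gtr0_norm// => tE.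
have [_] := cK y x t Dy Dx (introT andP (conj t0 t1)).
have -> : t *: y + (1 - t) *: x = x + t *: (y - x).
  by rewrite scalerBl scale1r scalerBr addrC -addrA [- _ + _]addrC.
move=> tK; move: tE; rewrite ler_norml => /andP[tE _].
have eN : e / (`|y - x| + 1) * `|y - x| <= e.
  by rewrite -mulrA ler_piMr ?(ltW e0)// mulrC ler_pdivrMr// mul1r lerDl.
suff : t * (K x + inner (gradient K x) (y - x)) <= t * (K y + e).
  by rewrite ler_pM2l.
have := ler_wpM2l (ltW t0) eN.
move: tE tK; rewrite mulrCA; set a := _ * `|_|; lra.
Qed.

(** A one-dimensional subgradient: [p] is the supremum of the backward difference quotients. Since
    [x] is a convex combination of [x - s e] and [x + t e], each backward quotient is at most each
    forward one. *)
Lemma exists_subslope A u x e : real_convex_on A u -> nbhs x A ->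
  exists p : R, \forall t \near (0 : R),
    A (x + t *: e) /\ t * p <= u (x + t *: e) - u x.
Proof.
move=> cu /nbhs0P Ax.
have [d d0 dA] := near0_ball (near0Z e Ax).
pose S := [set r | exists2 s, 0 < s < d & r = (u x - u (x + (- s) *: e)) / s].
have key s t : 0 < s < d -> 0 < t < d ->
    (u x - u (x + (- s) *: e)) / s <= (u (x + t *: e) - u x) / t.
  move=> /andP[s0 sd] /andP[t0 td].
  have As : A (x + (- s) *: e) by apply: dA; rewrite normrN gtr0_norm.
  have At : A (x + t *: e) by apply: dA; rewrite gtr0_norm.
  have st0 : 0 < s + t by rewrite addr_gt0.
  have th : 0 < s / (s + t) < 1.
    by rewrite divr_gt0//= ltr_pdivrMr// mul1r ltrDl.
  have [_] := cu _ _ _ At As th.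
  have -> : 1 - s / (s + t) = t / (s + t) by field; rewrite gt_eqF.
  have -> : (s / (s + t)) *: (x + t *: e) + (t / (s + t)) *: (x + (- s) *: e) = x.
    apply/rowP => i; rewrite !mxE; field; rewrite gt_eqF//.
  move=> uE; rewrite ler_pdivrMr// mulrAC ler_pdivlMr//.
  have : (s + t) * u x <= s * u (x + t *: e) + t * u (x + (- s) *: e).
    rewrite [leRHS](_ : _ = (s + t) * (s / (s + t) * u (x + t *: e) +
      t / (s + t) * u (x + (- s) *: e))) ?ler_pM2l//.
    by field; rewrite gt_eqF.
  move: (u _) (u _) (u _) => a b c; lra.
have hd : 0 < d / 2 < d by rewrite divr_gt0//= ltr_pdivrMr// ltr_pMr// ltr1n.
have ubS t : 0 < t < d -> ubound S ((u (x + t *: e) - u x) / t).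
  by move=> td r [s sd ->]; exact: key.
have S0 : S !=set0 by exists ((u x - u (x + (- (d / 2)) *: e)) / (d / 2)), (d / 2).
have hS : has_ubound S by exists ((u (x + (d / 2) *: e) - u x) / (d / 2)); exact: ubS.
exists (sup S); near=> t.
have td : `|t| < d.
  by near: t; apply/nbhs_ballP; exists d => //= t; rewrite -ball_normE /= sub0r normrN.
split; first exact: dA.
have [t0|t0|->] := ltgtP t 0; last by rewrite scale0r addr0 mul0r subrr.
- have : S ((u x - u (x + (- - t) *: e)) / (- t)).
    by exists (- t) => //; rewrite oppr_gt0 t0 -(ltr0_norm t0).
  move/(ub_le_sup hS); rewrite opprK ler_pdivrMr ?oppr_gt0//; lra.
- have : sup S <= (u (x + t *: e) - u x) / t.
    by apply: ge_sup => //; apply: ubS; rewrite t0 -(gtr0_norm t0).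
  by rewrite ler_pdivlMr// mulrC.
Unshelve. all: by end_near. Qed.

(* The subgradients p, q of u, v along e satisfy p + q = (u + v)'(x; e), so the
   remainders of u and v are nonnegative with an o(t) sum. *)
Lemma convex_summand_derivable A u v x e : real_convex_on A u ->
    real_convex_on A v -> nbhs x A -> differentiable (u \+ v) x ->
  exists p : R, forall eps : R, 0 < eps -> \forall t \near (0 : R),
    A (x + t *: e) /\ u (x + t *: e) - u x - t * p <= eps * `|t|.
Proof.
move=> cu cv Ax duv.
have [p pP] := exists_subslope e cu Ax; have [q qP] := exists_subslope e cv Ax.
set c := inner (gradient (u \+ v) x) e.
have cP eps : 0 < eps -> \forall t \near (0 : R),
    u (x + t *: e) + v (x + t *: e) - (u x + v x) - t * c <= eps * `|t|.
  move=> eps0; have N0 : 0 < `|e| + 1 by rewrite ltr_wpDl.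
  have e'0 : 0 < eps / (`|e| + 1) by rewrite divr_gt0.
  have := near0Z e (gradient_expansion duv e'0); apply: filterS => t.
  rewrite innerZr normrZ => /(le_trans (ler_norm _))/le_trans; apply.
  rewrite mulrCA mulrC ler_wpM2r// -mulrA ler_piMr ?(ltW eps0)//.
  by rewrite mulrC ler_pdivrMr// mul1r lerDl.
have pqP eps : 0 < eps -> \forall t \near (0 : R),
    t * (p + q) <= t * c + eps * `|t|.
  move=> eps0; near=> t.
  have [_ pt] : A (x + t *: e) /\ t * p <= u (x + t *: e) - u x by near: t.
  have [_ qt] : A (x + t *: e) /\ t * q <= v (x + t *: e) - v x by near: t.
  have ct : u (x + t *: e) + v (x + t *: e) - (u x + v x) - t * c <= eps * `|t|.
    by near: t; exact: cP.
  move: pt qt ct; lra.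
(* Small positive [t] gives [p + q <= c], small negative [t] the reverse. *)
have pqc : p + q = c.
  apply/eqP; rewrite eq_le; apply/andP; split; apply/ler_addgt0Pr => eps eps0.
    have /(near0_gt0 ltr01)[t /andP[t0 _]] := pqP _ eps0.
    by rewrite gtr0_norm// [eps * t]mulrC -mulrDr ler_pM2l.
  have := pqP _ eps0.
  rewrite -oppr0 nearN => /(near0_gt0 ltr01)[t /andP[t0 _]] /=.
  rewrite normrN gtr0_norm// => H.
  suff : t * c <= t * (p + q + eps) by rewrite ler_pM2l.
  by move: H; lra.
exists p => eps eps0; near=> t.
have [At pt] : A (x + t *: e) /\ t * p <= u (x + t *: e) - u x by near: t.
have [_ qt] : A (x + t *: e) /\ t * q <= v (x + t *: e) - v x by near: t.
have ct : u (x + t *: e) + v (x + t *: e) - (u x + v x) - t * c <= eps * `|t|.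
  by near: t; exact: cP.
split=> //; move: pt qt ct; rewrite -pqc; lra.
Unshelve. all: by end_near. Qed.

Lemma near0_scale (a : R) (P : 'rV[R]_n -> Prop) :
  (\forall w \near (0 : 'rV[R]_n), P w) ->
  \forall w \near (0 : 'rV[R]_n), P (a *: w).
Proof.
have := @scaler_continuous R 'rV[R]_n a 0.
by rewrite /continuous_at scaler0; exact.
Qed.

Lemma near0_double_coord (P : R -> Prop) (i : 'I_n) :
  (\forall t \near (0 : R), P t) ->
  \forall w \near (0 : 'rV[R]_n), P (2 * (w : 'rV[R]_n) 0 i).
Proof.
move=> nP.
have c := @coord_continuous R 1 n 0 i (0 : 'rV[R]_n).
have : \forall w \near (0 : 'rV[R]_n), P ((w : 'rV[R]_n) 0 i) by apply: c; rewrite mxE.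
by move/(near0_scale 2); apply: filterS => w; rewrite mxE.
Qed.

(** The directional estimates along the coordinates are joined by convexity into an upper bound on
    the remainder of [u], one coordinate at a time. The upper bound at [- w] then gives the lower
    bound at [w], as [x] is the midpoint of [x + w] and [x - w]. *)
Lemma convex_summand_differentiable A u v x : real_convex_on A u ->
    real_convex_on A v -> nbhs x A -> differentiable (u \+ v) x ->
  differentiable u x.
Proof.
move=> cu cv Ax duv.
have /boolp.choice[p pP] i :=
  convex_summand_derivable (delta_mx 0 i) cu cv Ax duv.
have half01 : 0 < (2^-1 : R) < 1 by lra.
have upper (s : seq 'I_n) (eps : R) : 0 < eps ->
    \forall w \near (0 : 'rV[R]_n),
      A (x + \sum_(i <- s) (w : 'rV[R]_n) 0 i *: delta_mx 0 i) /\
      u (x + \sum_(i <- s) w 0 i *: delta_mx 0 i) - u x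
        - \sum_(i <- s) w 0 i * p i <= eps * `|w|.
  elim: s eps => [|i s IHs] eps eps0.
    near=> w; rewrite !big_nil addr0 subrr subr0 mulr_ge0 ?(ltW eps0)//.
    by split=> //; exact: nbhs_singleton.
  (* The new point is the midpoint of a step along [i] and a step along [s], both doubled. Errors
     [eps / 2] times a doubled norm average to at most [eps] times the norm of [w]. *)
  have eps20 : 0 < eps / 2 by rewrite divr_gt0.
  have H1 := near0_scale 2 (IHs _ eps20).
  have H2 := near0_double_coord i (pP i _ eps20).
  apply: filterS2 H1 H2 => w [A1 u1] [A2 u2].
  have [] := cu _ _ _ A2 A1 half01.
  have -> : 2^-1 *: (x + (2 * w 0 i) *: delta_mx 0 i) + (1 - 2^-1) *:
      (x + \sum_(j <- s) (2 *: w) 0 j *: delta_mx 0 j) =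
      x + \sum_(j <- i :: s) w 0 j *: delta_mx 0 j.
    rewrite big_cons.
    have -> : \sum_(j <- s) (2 *: w) 0 j *: delta_mx 0 j =
        2 *: \sum_(j <- s) w 0 j *: delta_mx 0 j :> 'rV[R]_n.
      by rewrite scaler_sumr; apply: eq_bigr => j _; rewrite mxE scalerA.
    set S := \sum_(_ <- _) _.
    by apply/rowP => k; rewrite !mxE; field.
  move=> Aw uw; split=> //.
  have -> : \sum_(j <- i :: s) w 0 j * p j =
      w 0 i * p i + 2^-1 * \sum_(j <- s) (2 *: w) 0 j * p j.
    rewrite big_cons mulr_sumr; congr (_ + _); apply: eq_bigr => j _.
    by rewrite mxE; field.
  have wi := coord_le_norm w i.
  have : eps * `|w 0 i| <= eps * `|w| by rewrite ler_wpM2l ?(ltW eps0).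
  move: u1 u2 uw; rewrite normrZ normrM ger0_norm//.
  move: (u _) (u _) (u _) (u _) => a b c d; lra.
have up (eps : R) : 0 < eps -> \forall w \near (0 : 'rV[R]_n),
    A (x + w) /\ u (x + w) - u x - inner (\row_i p i) w <= eps * `|w|.
  move=> eps0; apply: filterS (upper (index_enum _) eps eps0) => w.
  rewrite -row_sum_delta => -[Aw uw]; split=> //; apply: le_trans uw.
  rewrite lerD2l lerN2 le_eqVlt; apply/orP; left; apply/eqP.
  by apply: eq_bigr => i _; rewrite mxE mulrC.
apply: (proj1 (differentiable_of_expansion (p := \row_i p i) _)) => eps eps0.
have upN : \forall w \near (0 : 'rV[R]_n),
    A (x - w) /\ u (x - w) - u x - inner (\row_i p i) (- w) <= eps * `|w|.
  apply: filterS (near0_scale (-1) (up _ eps0)) => w.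
  by rewrite scaleN1r normrN.
apply: filterS2 (up _ eps0) upN => w [Aw uw] [ANw uNw].
rewrite ler_norml uw andbT.
have [_] := cu _ _ _ Aw ANw half01.
have -> : 2^-1 *: (x + w) + (1 - 2^-1) *: (x - w) = x.
  by apply/rowP => k; rewrite !mxE; field.
move: uNw; rewrite innerNr.
move: (u _) (u _) (u _) => a b c; lra.
Unshelve. all: by end_near. Qed.

End Convex.

(** * Continuity of convex gradients, affine minorants and segments to the boundary *)

Section ConvexGradient.
Context {R : realType} {n : nat}.
Implicit Types (x y z p w e : 'rV[R]_n) (u v K : 'rV[R]_n -> R)
  (A D : set 'rV[R]_n).

Lemma mx_norm_le (M : 'rV[R]_n) (c : R) :
  0 <= c -> (forall i, `|M 0 i| <= c) -> `|M| <= c.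
Proof.
move=> c0 Mc; rewrite [leLHS]mx_normrE; apply/bigmax_leP; split=> // -[i j] _ /=.
by rewrite ord1.
Qed.

(** Fix [t] such that the difference quotient of [u] at [x] along [t e] exceeds the derivative by at
    most [eps / 2]. For this fixed [t] the quotient is continuous in the base point, and at each
    nearby point it dominates the derivative along [e]. *)
Lemma inner_gradient_usc A u x e (eps : R) : real_convex_on A u -> open A ->
    (forall y, A y -> differentiable u y) -> A x -> 0 < eps ->
  \forall y \near x, inner (gradient u y) e <= inner (gradient u x) e + eps.
Proof.
move=> cu oA du Ax eps0.
have nA y : A y -> \forall w \near (0 : 'rV[R]_n), A (y + w).
  by move=> Ay; have /nbhs0P := open_nbhs_nbhs (conj oA Ay).
have N0 : 0 < `|e| + 1 by rewrite ltr_wpDl.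
have e'0 : 0 < eps / 2 / (`|e| + 1) by rewrite !divr_gt0.
have Pw : \forall w \near (0 : 'rV[R]_n), A (x + w) /\
    `|u (x + w) - u x - inner (gradient u x) w| <= eps / 2 / (`|e| + 1) * `|w|.
  exact: filterI (nA _ Ax) (gradient_expansion (du _ Ax) e'0).
have := near0Z e Pw.
move=> /(near0_gt0 ltr01)[t /andP[t0 _] [Axt ut]].
move: ut => /(le_trans (ler_norm _)).
rewrite innerZr normrZ gtr0_norm// => ut.
have {}ut : u (x + t *: e) - u x - t * inner (gradient u x) e <= eps / 2 * t.
  have e1 : (`|e| + 1)^-1 * `|e| <= 1 by rewrite mulrC ler_pdivrMr// mul1r lerDl.
  have et : 0 <= eps / 2 * t by rewrite !mulr_ge0 ?(ltW eps0) ?(ltW t0).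
  by have := ler_wpM2l et e1; move: ut; set d := _^-1; lra.
have et0 : 0 < eps * t / 4 by rewrite divr_gt0 ?mulr_gt0.
have near_u y : A y -> \forall w \near (0 : 'rV[R]_n), `|u y - u (y + w)| <= eps * t / 4.
  move=> Ay; have /differentiable_continuous/cvgrPdist_le/(_ _ et0) := du _ Ay.
  by move/nbhs0P.
apply/nbhs0P; near=> w.
have Aw : A (x + w) by near: w; exact: nA.
have Atw : A (x + t *: e + w) by near: w; exact: nA.
have uw : `|u x - u (x + w)| <= eps * t / 4 by near: w; exact: near_u.
have utw : `|u (x + t *: e) - u (x + t *: e + w)| <= eps * t / 4.
  by near: w; exact: near_u.
rewrite -(ler_pM2l t0).
have := gradient_ineq cu (du _ Aw) Aw Atw.
rewrite (_ : x + t *: e + w - (x + w) = t *: e); last first.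
  by apply/rowP => i; rewrite !mxE; ring.
rewrite innerZr.
move: uw utw; rewrite !ler_norml => /andP[? ?] /andP[? ?] ?; lra.
Unshelve. all: by end_near. Qed.

(** Upper semicontinuity along a basis vector and along its opposite controls each coordinate from
    both sides. *)
Lemma gradient_continuous A u x : real_convex_on A u -> open A ->
    (forall y, A y -> differentiable u y) -> A x ->
  {for x, continuous (gradient u)}.
Proof.
move=> cu oA du Ax; apply/(cvgrPdist_le (FF := nbhs_filter x)) => eps eps0.
have key : \forall y \near x, forall i, `|gradient u x 0 i - gradient u y 0 i| <= eps.
  apply: (@filter_forall _ _ _ _ (nbhs_filter x)) => i.
  have := inner_gradient_usc (delta_mx 0 i) cu oA du Ax eps0.
  have := inner_gradient_usc (- delta_mx 0 i) cu oA du Ax eps0.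
  apply: filterS2 => y; rewrite !innerNr !inner_delta ler_norml => ? ?.
  by apply/andP; split; lra.
apply: filterS key => y yi; apply: mx_norm_le (ltW eps0) _ => i.
by have := yi i; rewrite !mxE.
Qed.

Lemma affine_minorant D K x : real_convex_on D K -> differentiable K x -> D x ->
  exists a b : R, 0 <= b /\ forall y, D y -> a - b * enorm y <= K y.
Proof.
move=> cK dK Dx; set g := gradient K x.
exists (K x - inner g x), (norm1 g); split; first exact: norm1_ge0.
move=> y Dy; apply: le_trans (gradient_ineq cK dK Dx Dy).
have := normr_inner_enorm g y; rewrite innerBr ler_norml => /andP[? _].
rewrite -/g; lra.
Qed.

(** A perturbation [w] of the segment point comes from the perturbation [t^-1 *: w] of [x0]. *)
Lemma segment_interior D K x x0 (t : R) : real_convex_on D K -> D x -> D° x0 ->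
  0 < t < 1 -> D° (t *: x0 + (1 - t) *: x).
Proof.
move=> cK Dx Dx0 t01; have /andP[t0 _] := t01.
have /nbhs0P/(near0_scale t^-1) : nbhs x0 D := Dx0.
move=> Dw; suff : \forall y \near t *: x0 + (1 - t) *: x, D y by [].
apply/nbhs0P; move: Dw.
apply: filterS => w Dw; have [+ _] := cK _ _ _ Dw Dx t01.
congr D; apply/rowP => i; rewrite !mxE; field; exact: lt0r_neq0.
Qed.

Lemma norm1_segment x x0 (t : R) : 0 <= t <= 1 ->
  norm1 (t *: x0 + (1 - t) *: x) <= norm1 x0 + norm1 x.
Proof.
move=> /andP[t0 t1]; rewrite /norm1 -big_split; apply: ler_sum => i _ /=.
rewrite !mxE; apply: le_trans (ler_normD _ _) _; rewrite !normrM.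
rewrite (ger0_norm t0) [`|1 - t|]ger0_norm ?subr_ge0//.
by apply: lerD; rewrite ler_piMl ?gerBl.
Qed.

(* By essential smoothness the gradient blows up at the boundary point x, so
   this says that then its slope towards x0 tends to -oo. *)
Lemma gradient_bounded_of_slope D K x x0 (b : R) : real_convex_on D K ->
    (forall y, D° y -> differentiable K y) -> D x -> D° x0 ->
  exists B : R, forall t : R, 0 < t < 1 ->
    - b <= inner (gradient K (t *: x0 + (1 - t) *: x)) (x0 - x) ->
    norm1 (gradient K (t *: x0 + (1 - t) *: x)) <= B.
Proof.
move=> cK dK Dx Dx0.
have /nbhs0P near_D : nbhs x0 D := Dx0.
have [r /andP[r0 _] rD] : exists2 r : R, 0 < r < 1 & forall i : 'I_n,
    D (x0 + r *: delta_mx 0 i) /\ D (x0 + r *: - delta_mx 0 i).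
  apply: near0_gt0 ltr01 _; apply: (@filter_forall _ _ _ _ (nbhs_filter (0 : R))) => i.
  by apply: filterI; apply: (near0Z _ near_D).
have Dx0' : D x0 by exact: interior_subset.
have [a [c [c0 Kac]]] := affine_minorant cK (dK _ Dx0) Dx0'.
pose N := norm1 x0 + norm1 x.
pose M i := `|K (x0 + r *: delta_mx 0 i)| + `|K (x0 + r *: - delta_mx 0 i)|.
pose B i := (M i - a + c * N + `|b|) / r.
exists (\sum_(i < n) B i) => t t01 slope; apply: ler_sum => i _.
have Dp := segment_interior cK Dx Dx0 t01.
set p := t *: x0 + (1 - t) *: x in slope Dp *.
have Dp' : D p by exact: interior_subset.
have Kp : a - c * N <= K p.
  apply: le_trans (Kac _ Dp'); rewrite lerD2l lerN2 ler_wpM2l//.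
  apply: le_trans (enorm_le_norm1 _) _; apply: norm1_segment.
  by case/andP: t01 => /ltW-> /ltW->.
have [Di DNi] := rD i.
have /andP[t0 t1] := t01.
(* The tangent inequality from [p] to [x0 + r w] involves [(1 - t) (x0 - x) + r w]. The slope
   hypothesis bounds the first part below, and the affine minorant bounds [K p] below, both
   uniformly in [t]. *)
have side w : D (x0 + r *: w) ->
    r * inner (gradient K p) w <= `|K (x0 + r *: w)| - a + c * N + `|b|.
  move=> Dw; have := gradient_ineq cK (dK _ Dp) Dp' Dw.
  rewrite (_ : x0 + r *: w - p = (1 - t) *: (x0 - x) + r *: w); last first.
    by apply/rowP => j; rewrite !mxE; ring.
  rewrite innerDr !innerZr.
  have : (1 - t) * - b <= (1 - t) * inner (gradient K p) (x0 - x).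
    by rewrite ler_wpM2l// subr_ge0 ltW.
  have : (1 - t) * b <= `|b|.
    apply: le_trans (_ : (1 - t) * `|b| <= _).
      by rewrite ler_wpM2l ?ler_norm// subr_ge0 ltW.
    by rewrite ler_piMl ?gerBl ?(ltW t0).
  have := ler_norm (K (x0 + r *: w)); move: Kp; lra.
rewrite /B ler_pdivlMr// mulrC -[r in r * _](gtr0_norm r0) -normrM ler_norml.
have := side _ Di; have := side _ DNi; rewrite /M innerNr !inner_delta.
have := normr_ge0 (K (x0 + r *: delta_mx 0 i)).
have := normr_ge0 (K (x0 + r *: - delta_mx 0 i)).
move=> ? ? ? ?; apply/andP; split; lra.
Qed.

(* For K finite on D: lower semicontinuity of K extended by +oo outside D. *)
Definition lsc_on D K := forall x (a : R), (D x -> a < K x) ->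
  \forall y \near x, D y -> a < K y.

End ConvexGradient.

(** * The combination [G = c H - F] up to the boundary of the domain *)

Section RelativeSmoothness.
Context {R : realType} {n : nat}.
Variables (D : set 'rV[R]_n) (H F : 'rV[R]_n -> R) (L c : R).
Hypotheses (L0 : 0 <= L) (Lc : L < c).

Let U x := L * H x + F x.
Let V x := L * H x - F x.
Let G x := c * H x - F x.

(** This form bounds [G] below on a segment, where convexity bounds [U] above. The form with [V] is
    a positive multiple of [H] plus a convex function. *)
Let GUE x : G x = (c + L) * H x - U x. Proof. by rewrite /G /U; ring. Qed.
Let GVE x : G x = (c - L) * H x + V x. Proof. by rewrite /G /V; ring. Qed.

(** The convex functions [U] and [V] add up to [2 L H], so [U] is differentiable, hence so is
    [F = U - L H]. *)
Lemma rel_smooth_differentiable A x : real_convex_on A U -> real_convex_on A V ->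
  nbhs x A -> differentiable H x -> differentiable F x.
Proof.
move=> cU cV Ax dH.
have dLH : differentiable (fun y => L * H y) x by exact: differentiableZ.
have dUV : differentiable (U \+ V) x.
  have -> : U \+ V = (fun y => L * H y) \+ (fun y => L * H y).
    by apply/funext => y; rewrite /U /V /=; ring.
  exact: differentiableD.
have dU := convex_summand_differentiable cU cV Ax dUV.
have -> : F = U \- (fun y => L * H y) by apply/funext => y; rewrite /U /=; ring.
exact: differentiableB.
Qed.

Lemma rel_smooth_gradient_continuous A x : real_convex_on A U -> open A ->
    (forall y, A y -> differentiable H y) -> (forall y, A y -> differentiable F y) ->
    {for x, continuous (gradient H)} -> A x ->
  {for x, continuous (gradient F)}.
Proof.
move=> cU oA dH dF gH Ax.
have dLH y : A y -> differentiable (fun y => L * H y) y.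
  by move=> Ay; apply: differentiableZ; exact: dH.
have dU y : A y -> differentiable U y.
  by move=> Ay; apply: (@differentiableD _ _ _ (fun y => L * H y)); auto.
have gU := gradient_continuous cU oA dU Ax.
have gE y : A y -> gradient U y - L *: gradient H y = gradient F y.
  move=> Ay; rewrite -gradientZ; last exact: dH.
  rewrite -(gradientB (dU _ Ay) (dLH _ Ay)); congr gradient.
  by apply/funext => z; rewrite /U /=; ring.
have : gradient U y - L *: gradient H y @[y --> x] --> gradient F x.
  rewrite -(gE _ Ax); apply: (@cvgB _ _ _ _ (nbhs_filter x)); first exact: gU.
  exact: (@cvgZl_tmp _ _ _ _ (nbhs_filter x) L _ _ gH).
apply: cvg_trans; apply: (@near_eq_cvg _ _ _ (nbhs_filter x)).
have nA : \forall y \near x, A y by exact: open_nbhs_nbhs.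
by apply: filterS nA => y Ay; rewrite gE.
Qed.

Hypotheses (cH : real_convex_on D H) (lH : lsc_on D H)
  (cU : real_convex_on D U) (cV : real_convex_on D V)
  (dH : forall y, D° y -> differentiable H y).

Let cL0 : 0 < c - L. Proof. by rewrite subr_gt0. Qed.

Let dF y : D° y -> differentiable F y.
Proof. by move=> Dy; apply: (rel_smooth_differentiable cU cV Dy); exact: dH. Qed.

Let dV y : D° y -> differentiable V y.
Proof.
move=> Dy; apply: (@differentiableB _ _ _ (fun y => L * H y)); last exact: dF.
by apply: differentiableZ; exact: dH.
Qed.

Let dG y : D° y -> differentiable G y.
Proof.
move=> Dy; apply: (@differentiableB _ _ _ (fun y => c * H y)); last exact: dF.
by apply: differentiableZ; exact: dH.
Qed.

Let gGE y : D° y -> gradient G y = (c - L) *: gradient H y + gradient V y.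
Proof.
move=> Dy; rewrite -(gradientZ _ (dH Dy)) -gradientD; last exact: dV.
  by congr (gradient _ y); apply/funext => z; exact: GVE.
by apply: differentiableZ; exact: dH.
Qed.

Let subD y : D° y -> D y. Proof. exact: interior_subset. Qed.

Let cG : real_convex_on D G.
Proof.
move=> x y t Dx Dy t01; have [Dz Hz] := cH Dx Dy t01; have [_ Vz] := cV Dx Dy t01.
split=> //; rewrite !GVE; have := ler_wpM2l (ltW cL0) Hz; move: Vz; lra.
Qed.

Variable x0 : 'rV[R]_n.
Hypothesis Dx0 : D° x0.

Lemma scaled_sub_lsc : lsc_on D G.
Proof.
move=> x a aG; have [Dx|NDx] := pselect (D x); last first.
  have [a' [b [b0 Vb]]] := affine_minorant cV (dV Dx0) (subD Dx0).
  have nx : \forall y \near x, norm1 y < norm1 x + 1.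
    by apply: (@cvgr_lt _ _ _ _ _ _ (@norm1_continuous R n x)); rewrite ltrDl.
  (* Chosen so that [(c - L) m] plus the lower bound of [V] near [x] equals [a]. *)
  pose m := (a - a' + b * (norm1 x + 1)) / (c - L).
  have nH : \forall y \near x, D y -> m < H y by apply: lH => /NDx.
  apply: filterS2 nx nH => y ny mH Dy.
  have := mH Dy; rewrite /m ltr_pdivrMr// GVE => ?.
  have := Vb _ Dy.
  have := ler_wpM2l b0 (le_trans (enorm_le_norm1 y) (ltW ny)); lra.
have {}aG := aG Dx.
pose E := G x - a; have E0 : 0 < E by rewrite subr_gt0.
(* [M] gathers the terms linear in [t]: those from convexity of [U] on the segment, and those from
   bounding the tangent at [p] by its value at [x0]. The final margin is [E - E / 4 - t M]. *)
pose M := U x0 - U x + G x0 - a.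
have cL : 0 < c + L by rewrite ltr_wpDr// (le_lt_trans L0).
have e0 : 0 < E / 4 / (c + L) by rewrite !divr_gt0.
have /nbhs0P/(near0Z (x0 - x)) : \forall y \near x, D y -> H x - E / 4 / (c + L) < H y.
  by apply: lH => _; rewrite ltrBlDr ltrDl.
move=> nH.
have e1 : 0 < Num.min 1 (E / 4 / (`|M| + 1)).
  by rewrite lt_min ltr01 !divr_gt0// ltr_wpDl.
have [t /andP[t0]] := near0_gt0 e1 nH.
rewrite lt_min => /andP[t1 tM].
have -> : x + t *: (x0 - x) = t *: x0 + (1 - t) *: x.
  by apply/rowP => i; rewrite !mxE; ring.
have t01 : 0 < t < 1 by rewrite t0.
have Dp := segment_interior cH Dx Dx0 t01.
have [_ Up] := cU (subD Dx0) Dx t01.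
set p := t *: x0 + (1 - t) *: x in Dp Up * => Hp.
have {}Hp := Hp (subD Dp).
have {}tM : t * `|M| < E / 2.
  have : t * (`|M| + 1) < E / 4 by rewrite -ltr_pdivlMr// ltr_wpDl.
  lra.
have tM' : t * M <= t * `|M| by rewrite ler_wpM2l ?ler_norm// ltW.
set g := gradient G p.
have Gp y : D y -> G p + inner g (y - p) <= G y.
  by move=> Dy; exact: gradient_ineq cG (dG Dp) (subD Dp) Dy.
(* The tangent at [p] lies below [G x0] at [x0]. As [p] is between [x0] and [x], this bounds the
   tangent from below at [x]: multiplied by [1 - t], its value there is at least [G p - t G x0]. *)
have Gx : a < G p + inner g (x - p).
  have := Gp _ (subD Dx0).
  have -> : x0 - p = (1 - t) *: (x0 - x) by apply/rowP => i; rewrite !mxE; ring.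
  have -> : x - p = (- t) *: (x0 - x) by apply/rowP => i; rewrite !mxE; ring.
  rewrite !innerZr; set q := inner _ _ => Gq.
  have t1' : 0 < 1 - t by rewrite subr_gt0.
  rewrite -(ltr_pM2l t1').
  have := ler_wpM2l (ltW t0) Gq.
  have : (c + L) * H x - E / 4 < (c + L) * H p.
    have := Hp; rewrite -(ltr_pM2l cL) mulrBr.
    by rewrite [(c + L) * (_ / _)]mulrC divfK// gt_eqF.
  have := GUE p; have := GUE x; move: Up tM tM'; rewrite /M /E; lra.
have : \forall y \near x, a < G p + inner g (y - p).
  have cvl : G p + inner g (y - p) @[y --> x] --> G p + inner g (x - p).
    have -> : (fun y => G p + inner g (y - p)) =
        (fun y => (G p - inner g p) + inner g y).
      by apply/funext => y; rewrite innerBr; ring.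
    rewrite innerBr addrCA addrC addrAC.
    rewrite [X in _ --> X](_ : _ = (G p - inner g p) + inner g x); last by ring.
    apply: (@cvgD _ _ _ _ (nbhs_filter x)); last exact: inner_continuous.
    exact: (@cvg_cst _ _ _ _ (nbhs_filter x)).
  exact: (@cvgr_gt _ _ _ _ _ _ cvl).
by apply: filterS => y ay /Gp; exact: lt_le_trans.
Qed.

(** The tangent inequalities at the points [u k] with gradient below [C] pass to the limit by lower
    semicontinuity of [G]. Outside [D] that semicontinuity would make [G (u k)] exceed every bound,
    contradicting the inequality at [x0]. *)
Lemma scaled_sub_subgradient_at_limit (u : nat -> 'rV[R]_n) x (C : R) :
    (forall k, D° (u k)) -> u @ \oo --> x ->
    (forall N, exists2 k, (N <= k)%N & enorm (gradient G (u k)) < C) ->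
  D x /\ forall y, D y -> G x - C * norm1 (y - x) <= G y.
Proof.
move=> Du ux frq.
have C0 : 0 < C by have [k _] := frq 0%N; apply: le_lt_trans; exact: enorm_ge0.
(* The conditional premise serves twice: with arbitrary [a] to refute [~ D x], then with [a] just
   below [G x]. *)
have key a y : (D x -> a < G x) -> D y -> a - C * norm1 (y - x) <= G y.
  move=> aG Dy; apply/ler_addgt0Pr => e e0.
  have eC : 0 < e / C by rewrite divr_gt0.
  have n1 : \forall z \near x, D z -> a < G z by exact: scaled_sub_lsc.
  have n2 : \forall z \near x, norm1 (x - z) < e / C.
    have cvn : norm1 (x - z) @[z --> x] --> norm1 (x - x).
      apply: (cvg_comp (fun z => x - z)); last exact: norm1_continuous.
      apply: (@cvgB _ _ _ _ (nbhs_filter x)); last exact: cvg_id.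
      exact: (@cvg_cst _ _ _ _ (nbhs_filter x)).
    apply: (@cvgr_lt _ _ _ _ _ _ cvn); rewrite subrr.
    by rewrite /norm1 big1// => i _; rewrite mxE normr0.
  have [N _ Nk] := ux _ (filterI n1 n2).
  have [k Nlek gk] := frq N.
  have [/(_ (subD (Du k))) ak uk] := Nk k Nlek.
  have := gradient_ineq cG (dG (Du k)) (subD (Du k)) Dy.
  have gC i : `|gradient G (u k) 0 i| <= C.
    exact: le_trans (coord_le_enorm _ _) (ltW gk).
  have := normr_inner_le (y - u k) gC; rewrite ler_norml => /andP[? _].
  have : C * norm1 (y - u k) <= C * norm1 (y - x) + e.
    have -> : e = C * (e / C) by rewrite mulrC divfK// gt_eqF.
    rewrite -mulrDr ler_pM2l//; apply: le_trans (lerD (lexx _) (ltW uk)).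
    rewrite /norm1 -big_split; apply: ler_sum => i _ /=; rewrite !mxE.
    by apply: le_trans (ler_normD _ _); rewrite addrA subrK.
  lra.
have Dx : D x.
  apply: contrapT => NDx.
  have := key (G x0 + C * norm1 (x0 - x) + 1) x0 (fun Dx => False_ind _ (NDx Dx)) (subD Dx0).
  lra.
split=> // y Dy; apply/ler_addgt0Pr => e e0.
have ae : D x -> G x - e < G x by rewrite ltrBlDr ltrDl.
by have := key _ _ ae Dy; lra.
Qed.

Lemma scaled_sub_essentially_smooth :
    (forall (u : nat -> 'rV[R]_n) x, (forall k, D° (u k)) ->
      (closure D `\` D°) x -> u @ \oo --> x ->
      enorm (gradient H (u k)) @[k --> \oo] --> +oo) ->
  forall (u : nat -> 'rV[R]_n) x, (forall k, D° (u k)) ->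
    (closure D `\` D°) x -> u @ \oo --> x ->
    enorm (gradient G (u k)) @[k --> \oo] --> +oo.
Proof.
move=> esH u x Du bx ux; apply/cvgryPge => C; apply: contrapT => NC.
have frq N : exists2 k, (N <= k)%N & enorm (gradient G (u k)) < C.
  apply: contrapT => Nfrq; apply: NC; exists N => // k /= Nk.
  by rewrite leNgt; apply/negP => gC; apply: Nfrq; exists k.
have [Dx Gx] := scaled_sub_subgradient_at_limit Du ux frq.
have C0 : 0 < C by have [k _] := frq 0%N; apply: le_lt_trans; exact: enorm_ge0.
pose S := norm1 (x0 - x).
have [a [b [b0 Vab]]] := affine_minorant cV (dV Dx0) (subD Dx0).
pose N := norm1 x0 + norm1 x.
(* [- C * S] bounds the slope of [G] towards [x0] from below; the other term bounds that of [V] from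
   above. The factor 2 comes from [1 - t k >= 1 / 2]. *)
pose B2 := C * S + 2 * `|V x0 - (a - b * N)|.
have [B BP] := gradient_bounded_of_slope (B2 / (c - L)) cH dH Dx Dx0.
(* The index starts at 2 so that [t k] is at most one half; this is the harmonic sequence shifted by
   one. *)
pose t k : R := k.+2%:R^-1.
pose q k := t k *: x0 + (1 - t k) *: x.
have t01 k : 0 < t k < 1.
  by rewrite /t invr_gt0 ltr0n/= invf_lt1 ?ltr0n// ltr1n.
have t2 k : t k <= 2^-1 by rewrite /t lef_pV2 ?posrE ?ltr0n// ler_nat.
have Dq k : D° (q k) by exact: segment_interior cH Dx Dx0 (t01 k).
have slope k : - (B2 / (c - L)) <= inner (gradient H (q k)) (x0 - x).
  have /andP[t0 t1] := t01 k.
  rewrite -mulNr ler_pdivrMr// mulrC.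
  have Vq : a - b * N <= V (q k).
    apply: le_trans (Vab _ (subD (Dq k))); rewrite lerD2l lerN2 ler_wpM2l//.
    apply: le_trans (enorm_le_norm1 _) _; apply: norm1_segment.
    by rewrite (ltW t0) (ltW t1).
  have := gradient_ineq cG (dG (Dq k)) (subD (Dq k)) Dx.
  have := gradient_ineq cV (dV (Dq k)) (subD (Dq k)) (subD Dx0).
  have -> : x0 - q k = (1 - t k) *: (x0 - x).
    by apply/rowP => i; rewrite !mxE; ring.
  have -> : x - q k = (- t k) *: (x0 - x).
    by apply/rowP => i; rewrite !mxE; ring.
  have := Gx _ (subD (Dq k)).
  have -> : q k - x = t k *: (x0 - x) by apply/rowP => i; rewrite !mxE; ring.
  rewrite norm1Z gtr0_norm// -/S !innerZr gGE// innerDl innerZl.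
  set gh := inner (gradient H _) _; set gv := inner (gradient V _) _.
  move=> G1 V1 G2.
  have : - (C * S) <= (c - L) * gh + gv.
    by rewrite -(ler_pM2l t0); move: G1 G2; lra.
  have : gv <= 2 * `|V x0 - (a - b * N)|.
    have [gv0|gv0] := leP gv 0; first by rewrite (le_trans gv0)// mulr_ge0.
    have := ler_norm (V x0 - (a - b * N)).
    have := ler_wpM2r (ltW gv0) (t2 k); move: V1 Vq; lra.
  by move=> gvle sle; rewrite /B2 opprD lerBlDr (le_trans sle)// lerD2l.
have qx : q @ \oo --> x.
  have t_0 : t @ \oo --> 0.
    have := @cvg_harmonic R; rewrite -(cvg_shiftS (@harmonic R)).
    by apply: cvg_trans; apply: near_eq_cvg; near=> k.
  have -> : q = (fun k => x + t k *: (x0 - x)).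
    by apply/funext => k; apply/rowP => i; rewrite !mxE; ring.
  have : x + t k *: (x0 - x) @[k --> \oo] --> x + 0 *: (x0 - x).
    by apply: cvgD; [exact: cvg_cst|exact: cvgZr_tmp].
  by rewrite scale0r addr0.
have /cvgryPge/(_ (B + 1))[K _ /(_ K (leqnn K)) /=] := esH q x Dq bx qx.
move=> /le_trans/(_ (enorm_le_norm1 _))/le_trans/(_ (BP _ (t01 K) (slope K))).
by rewrite leNgt ltrDl ltr01.
Unshelve. all: by end_near. Qed.

End RelativeSmoothness.

(** * Passage between extended-valued functions and real representatives *)

Section Extension.
Context {R : realType} {n : nat}.
Implicit Types (D : set 'rV[R]_n) (K : 'rV[R]_n -> R) (k : 'rV[R]_n -> \bar R).

(** [K] is arbitrary outside [D], for instance 0 when [K] is [fine \o k], so every real statement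
    about it is relative to [D]. *)
Definition extends D K k :=
  (forall x, D x -> k x = (K x)%:E) /\ (forall x, ~ D x -> k x = +oo%E).

Lemma proper_extends k : proper_fun k -> extends (edom k) (fine \o k) k.
Proof.
move=> [kNy _]; split=> x; rewrite /edom /=; move: (kNy x).
  by case: (k x).
by case: (k x) => // r _ /(_ (ltry r)).
Qed.

Lemma extends_edom D K k : extends D K k -> edom k = D.
Proof.
move=> [kD kND]; apply/seteqP; split=> x; rewrite /edom /=.
  by move=> kx; apply: contrapT => /kND kE; move: kx; rewrite kE ltxx.
by move=> /kD ->; exact: ltry.
Qed.

Lemma extends_proper D K k : extends D K k -> D !=set0 -> proper_fun k.
Proof.
move=> kE [x Dx]; split; last by exists x; rewrite (extends_edom kE).
move=> y; have [Dy|NDy] := pselect (D y); first by rewrite (kE.1 _ Dy).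
by rewrite (kE.2 _ NDy).
Qed.

Lemma extends_lsc D K k : extends D K k ->
  lower_semicontinuous k <-> lsc_on D K.
Proof.
move=> kE; split=> lk x a aK.
  have akx : (a%:E < k x)%E.
    have [Dx|NDx] := pselect (D x); last by rewrite (kE.2 _ NDx) ltry.
    by rewrite (kE.1 _ Dx) lte_fin; exact: aK.
  have [W xW Wk] := lk _ _ akx; apply: filterS xW => y /Wk aky Dy.
  by move: aky; rewrite (kE.1 _ Dy) lte_fin.
exists [set y | D y -> a < K y].
  by apply: lk => Dx; move: aK; rewrite (kE.1 _ Dx) lte_fin.
move=> y /= aKy; have [Dy|NDy] := pselect (D y); last by rewrite (kE.2 _ NDy) ltry.
by rewrite (kE.1 _ Dy) lte_fin; exact: aKy.
Qed.

Lemma convex_on_real A K k : (forall x, A x -> k x = (K x)%:E) ->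
  convex_on A k -> real_convex_on A K.
Proof.
move=> kE ck x y t Ax Ay t01; have [Az] := ck _ _ _ Ax Ay t01.
by rewrite !kE// -!EFinM -EFinD lee_fin.
Qed.

(** For points of [D] the right-hand side is finite, which forces the combination into [D]:
    convexity of the domain comes from that of [k]. *)
Lemma extends_convex D K k : extends D K k ->
  convex_on setT k <-> real_convex_on D K.
Proof.
move=> kE; split=> ck x y t; last first.
  move=> _ _ t01; split=> //; have /andP[t0 t1] := t01.
  have t1' : 0 < 1 - t by rewrite subr_gt0.
  have [Dx|NDx] := pselect (D x); last first.
    rewrite (kE.2 _ NDx) gt0_muley ?lte_fin// addye ?leey//.
    have [Dy|NDy] := pselect (D y); first by rewrite (kE.1 _ Dy) -EFinM.
    by rewrite (kE.2 _ NDy) gt0_muley ?lte_fin.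
  have [Dy|NDy] := pselect (D y); last first.
    by rewrite (kE.2 _ NDy) gt0_muley ?lte_fin// (kE.1 _ Dx) -EFinM addey ?leey.
  have [Dz Kz] := ck _ _ _ Dx Dy t01.
  by rewrite !kE.1// -!EFinM -EFinD lee_fin.
move=> Dx Dy t01; have [_] := ck x y t I I t01.
rewrite (kE.1 _ Dx) (kE.1 _ Dy) -!EFinM -EFinD => kz.
have Dz : D (t *: x + (1 - t) *: y).
  by apply: contrapT => /kE.2 kz'; move: kz; rewrite kz' leye_eq.
by split=> //; move: kz; rewrite kE.1.
Qed.

Lemma extends_grad D K k x : extends D K k -> D° x -> differentiable K x ->
  differentiable (fine \o k) x /\ grad k x = gradient K x.
Proof.
move=> kE Dx dK; apply: near_eq_gradient dK.
by apply: filterS Dx => y Dy; rewrite /= kE.1.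
Qed.

Lemma extends_C1 D K k : extends D K k ->
    (forall x, D° x -> differentiable K x) ->
    (forall x, D° x -> {for x, continuous (gradient K)}) ->
  C1_on D° k.
Proof.
move=> kE dK gK; split=> x Dx; first exact: (extends_grad kE Dx (dK _ Dx)).1.
rewrite /prop_for /continuous_at (extends_grad kE Dx (dK _ Dx)).2.
apply: cvg_trans (gK _ Dx); apply: (@near_eq_cvg _ _ _ (nbhs_filter x)).
have nD : \forall y \near x, D° y by exact: nbhs_interior.
by apply: filterS nD => y Dy; rewrite (extends_grad kE Dy (dK _ Dy)).2.
Qed.

Lemma extends_essentially_smooth D K k : extends D K k ->
    (forall x, D° x -> differentiable K x) ->
    (forall (u : nat -> 'rV[R]_n) x, (forall i, D° (u i)) ->
      (closure D `\` D°) x -> u @ \oo --> x ->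
      enorm (gradient K (u i)) @[i --> \oo] --> +oo) ->
  essentially_smooth k.
Proof.
move=> kE dK es; rewrite /essentially_smooth (extends_edom kE) => u x Du bx ux.
have gE : (fun i => enorm (grad k (u i))) = (fun i => enorm (gradient K (u i))).
  by apply/funext => i; rewrite (extends_grad kE (Du i) (dK _ (Du i))).2.
by rewrite gE; exact: es bx ux.
Qed.

Lemma extends_bregman D K k x : extends D K k -> D° x -> differentiable K x ->
  extends D (fun z => K z - K x - inner (gradient K x) (z - x))
    (fun z => bregman k z x).
Proof.
move=> kE Dx dK; have [_ gE] := extends_grad kE Dx dK.
have kx := kE.1 _ (interior_subset Dx).
split=> z Dz; rewrite /bregman (extends_edom kE) gE kx asboolT//.
  by rewrite (kE.1 _ Dz).
by rewrite (kE.2 _ Dz).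
Qed.

Lemma extends_strictly_convex D K k : extends D K k ->
  strictly_convex k <->
  (forall x y t, D x -> D y -> x != y -> 0 < t < 1 ->
     D (t *: x + (1 - t) *: y) /\
     K (t *: x + (1 - t) *: y) < t * K x + (1 - t) * K y).
Proof.
move=> kE; rewrite /strictly_convex (extends_edom kE).
split=> sk x y t Dx Dy xy t01; last first.
  have [Dz Kz] := sk x y t Dx Dy xy t01.
  by rewrite !kE.1// -!EFinM -EFinD lte_fin.
have := sk x y t Dx Dy xy t01.
rewrite (kE.1 _ Dx) (kE.1 _ Dy) -!EFinM -EFinD => kz.
have Dz : D (t *: x + (1 - t) *: y).
  by apply: contrapT => /kE.2 kz'; move: kz; rewrite kz' ltNge leey.
by split=> //; move: kz; rewrite kE.1.
Qed.

Lemma extends_one_coercive D K k : extends D K k ->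
  one_coercive k <->
  (forall M : R, exists r : R, forall x, r < enorm x -> D x -> M * enorm x <= K x).
Proof.
(* The maximum with 0 makes [enorm x] positive, so its extended inverse is the real one. *)
move=> kE; split=> ck M; have [r rM] := ck M; exists (Num.max r 0) => x.
  rewrite gt_max => /andP[rx x0] Dx; have := rM _ rx.
  by rewrite (kE.1 _ Dx) inver gt_eqF// -EFinM lee_fin ler_pdivlMr.
rewrite gt_max => /andP[rx x0]; rewrite inver gt_eqF//.
have [Dx|NDx] := pselect (D x); last first.
  by rewrite (kE.2 _ NDx) gt0_mulye ?leey// lte_fin invr_gt0.
by rewrite (kE.1 _ Dx) -EFinM lee_fin ler_pdivlMr// rM.
Qed.

End Extension.

(** * The kernel [h / gamma - f]: Bregman identities and Legendre properties *)

Section Legendre.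
Context {R : realType} {n : nat}.
Variables (h f : 'rV[R]_n -> \bar R) (L gamma : R).
Hypotheses (lh : legendre h) (sf : rel_smooth L h f)
  (gamma0 : 0 < gamma) (gammaL : (gamma%:E < L%:E^-1)%E).

Let D := edom h.
Let H : 'rV[R]_n -> R := fine \o h.
Let F : 'rV[R]_n -> R := fine \o f.
Let G x := gamma^-1 * H x - F x.

Let L0 : 0 <= L. Proof. by case: sf => _ []. Qed.

Let Lgamma : L < gamma^-1.
Proof.
(* For [L = 0] the extended inverse is [+oo], and the claim is positivity of [gamma^-1]. *)
move: gammaL; rewrite inver; case: ifPn => [/eqP-> _|LN0]; first by rewrite invr_gt0.
rewrite lte_fin => gL; have Lp : 0 < L by rewrite lt_neqAle eq_sym LN0.
by rewrite -[L]invrK ltf_pV2 ?posrE ?invr_gt0.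
Qed.

Let hE : extends D H h.
Proof. by case: lh => -[ph _ _] _; exact: proper_extends. Qed.

Let fE x : D x -> f x = (F x)%:E.
Proof.
case: sf => -[pf _ hf] _ Dx.
exact: (proper_extends pf).1 _ (hf _ Dx).
Qed.

Let dH x : D° x -> differentiable H x.
Proof. by case: lh => _ [_ [dh _] _ _ _]; exact: dh. Qed.

Let UE x : D x -> (L%:E * h x + f x)%E = (L * H x + F x)%:E.
Proof. by move=> Dx; rewrite (hE.1 _ Dx) fE// -EFinM -EFinD. Qed.

Let VE x : D x -> (L%:E * h x - f x)%E = (L * H x - F x)%:E.
Proof. by move=> Dx; rewrite (hE.1 _ Dx) fE// -EFinM -EFinB. Qed.

(** Convexity on the interior yields differentiability of [F] there, on which the Bregman identities
    rest. *)
Let cUi : real_convex_on D° (fun x => L * H x + F x).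
Proof.
case: sf => _ [_ cU _]; apply: convex_on_real cU => x Dx.
by rewrite UE//; exact: interior_subset.
Qed.

Let cVi : real_convex_on D° (fun x => L * H x - F x).
Proof.
case: sf => _ [_ _ cV]; apply: convex_on_real cV => x Dx.
by rewrite VE//; exact: interior_subset.
Qed.

Let dF x : D° x -> differentiable F x.
Proof.
move=> Dx; apply: (rel_smooth_differentiable cUi cVi); last exact: dH.
exact: nbhs_interior.
Qed.

(** Outside [D] the dual addition returns [+oo] even where [f] is [+oo] too. *)
Lemma scaled_sub_extends :
  extends D G (fun x => gamma^-1%:E * h x - f x)%dE.
Proof.
split=> x Dx; first by rewrite (hE.1 _ Dx) fE// -EFinM.
by rewrite (hE.2 _ Dx) gt0_muley ?lte_fin ?invr_gt0// DualAddTheoryNumDomain.daddye.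
Qed.

Lemma sub_scaled_extends :
  extends D (fun x => H x - gamma * F x) (fun x => h x - gamma%:E * f x)%dE.
Proof.
split=> x Dx; first by rewrite (hE.1 _ Dx) fE// -EFinM.
by rewrite (hE.2 _ Dx) DualAddTheoryNumDomain.daddye.
Qed.

Let dG x : D° x -> differentiable G x.
Proof.
move=> Dx; apply: (@differentiableB _ _ _ (fun y => gamma^-1 * H y)); last exact: dF.
by apply: differentiableZ; exact: dH.
Qed.

Let gGE x : D° x -> gradient G x = gamma^-1 *: gradient H x - gradient F x.
Proof.
move=> Dx; rewrite -gradientZ; last exact: dH.
by rewrite -gradientB//; [apply: differentiableZ; exact: dH|exact: dF].
Qed.

Lemma scaled_sub_bregman : forall x, D° x ->
  extends D (fun z => G z - G x - inner (gamma^-1 *: grad h x - grad f x) (z - x))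
    (fun z => bregman (fun x => gamma^-1%:E * h x - f x)%dE z x).
Proof.
by move=> x Dx; have := extends_bregman scaled_sub_extends Dx (dG Dx); rewrite gGE.
Qed.

(** [h - gamma f] is [gamma] times [h / gamma - f], and the Bregman distance is homogeneous in its
    kernel. *)
Lemma sub_scaled_bregman x z : D° x ->
  (gamma^-1%:E * bregman (fun x => h x - gamma%:E * f x)%dE z x =
   bregman (fun x => gamma^-1%:E * h x - f x)%dE z x)%E.
Proof.
move=> Dx; have gF := differentiableZ gamma (dF Dx).
have dK : differentiable (fun y => H y - gamma * F y) x.
  by apply: differentiableB => //; exact: dH.
have bK := extends_bregman sub_scaled_extends Dx dK.
have bG := scaled_sub_bregman Dx.
have [Dz|NDz] := pselect (D z); last first.
  by rewrite (bK.2 _ NDz) (bG.2 _ NDz) gt0_muley// lte_fin invr_gt0.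
rewrite (bK.1 _ Dz) (bG.1 _ Dz) -EFinM; congr EFin.
rewrite (_ : gradient _ x = grad h x - gamma *: grad f x); last first.
  rewrite -[grad f x]/(gradient F x) -(gradientZ _ (dF Dx)) -gradientB//.
  exact: dH.
rewrite !innerBl !innerZl /G; field; exact: lt0r_neq0.
Qed.

(** On [D] the part of the Bregman distance due to [- f] replaces [f z] by the linearization of [f]
    at [x]. Off [D] both Bregman terms are [+oo], and no summand is [-oo]. *)
Lemma fb_identity (g : 'rV[R]_n -> \bar R) z x : proper_fun g -> D° x ->
  (f z + g z + bregman (fun x => gamma^-1%:E * h x - f x)%dE z x =
   f x + (inner (grad f x) (z - x)%R)%:E + g z + gamma^-1%:E * bregman h z x)%E.
Proof.
move=> [gNy _] Dx; have bG := scaled_sub_bregman Dx.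
have bH := extends_bregman hE Dx (dH Dx).
have fx := fE (interior_subset Dx).
have [Dz|NDz] := pselect (D z).
  rewrite (bG.1 _ Dz) (bH.1 _ Dz) fE// fx -!EFinM.
  have := gNy z; case: (g z) => // r _; rewrite -?EFinD//.
  rewrite -[gradient H x]/(grad h x) innerBl innerZl /G; congr EFin; ring.
rewrite (bG.2 _ NDz) (bH.2 _ NDz) fx gt0_muley ?lte_fin ?invr_gt0//.
have fNy : f z != -oo%E by case: sf => -[[]].
by rewrite !addey//; have := gNy z; case: (g z) fNy => //; case: (f z).
Qed.

Lemma scaled_sub_legendre :
    convex_on D (fun x => L%:E * h x + f x)%E ->
    convex_on D (fun x => L%:E * h x - f x)%E ->
  legendre (fun x => gamma^-1%:E * h x - f x)%dE.
Proof.
move=> /(convex_on_real UE) cU /(convex_on_real VE) cV.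
case: lh => -[_ /(extends_lsc hE) lH /(extends_convex hE) cH].
move=> [[x0 Dx0] [_ gH] sH esH /(extends_one_coercive hE) coH].
have kE := scaled_sub_extends.
have cL0 : 0 < gamma^-1 - L by rewrite subr_gt0.
have GE x : G x = (gamma^-1 - L) * H x + (L * H x - F x) by rewrite /G; ring.
have cGs x y t : D x -> D y -> x != y -> 0 < t < 1 ->
    D (t *: x + (1 - t) *: y) /\
    G (t *: x + (1 - t) *: y) < t * G x + (1 - t) * G y.
  move=> Dx Dy xy t01.
  have [Dz Hz] := (extends_strictly_convex hE).1 sH x y t Dx Dy xy t01.
  have [_ Vz] := cV x y t Dx Dy t01; split=> //.
  rewrite !GE; move: Hz; rewrite -(ltr_pM2l cL0); move: Vz; lra.
have cG : real_convex_on D G.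
  move=> x y t Dx Dy t01; have [->|xy] := eqVneq x y.
    by rewrite -scalerDl addrC subrK scale1r -mulrDl addrC subrK mul1r.
  by have [? /ltW] := cGs x y t Dx Dy xy t01.
have ekE := extends_edom kE.
split; [split|split].
- by apply: (extends_proper kE); exists x0; exact: interior_subset.
- apply/(extends_lsc kE).
  exact: (scaled_sub_lsc L0 Lgamma cH lH cU cV dH Dx0).
- exact/(extends_convex kE).
- by rewrite ekE; exists x0.
- rewrite ekE; apply: (extends_C1 kE dG) => x Dx.
  have gF := rel_smooth_gradient_continuous cUi (open_interior D) dH dF (gH _ Dx) Dx.
  have : gamma^-1 *: gradient H y - gradient F y @[y --> x] --> gradient G x.
    rewrite gGE//; apply: (@cvgB _ _ _ _ (nbhs_filter x)) => //.
    by apply: (@cvgZl_tmp _ _ _ _ (nbhs_filter x)); exact: gH.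
  apply: cvg_trans; apply: (@near_eq_cvg _ _ _ (nbhs_filter x)).
  have nD : \forall y \near x, D° y by exact: nbhs_interior.
  by apply: filterS nD => y Dy; rewrite gGE.
- exact/(extends_strictly_convex kE).
- apply: (extends_essentially_smooth kE dG).
  exact: (scaled_sub_essentially_smooth L0 Lgamma cH lH cU cV dH Dx0 esH).
- apply/(extends_one_coercive kE) => M.
  have dV : differentiable (fun x => L * H x - F x) x0.
    apply: (@differentiableB _ _ _ (fun y => L * H y)); last exact: dF.
    by apply: differentiableZ; exact: dH.
  have [a [b [b0 Vab]]] := affine_minorant cV dV (interior_subset Dx0).
  (* The growth of [h] must pay for the slope [b] of the minorant of [V] and for its constant [a];
     the latter is at least [- |a| * enorm x] once [enorm x > 1]. *)
  have [r rM] := coH ((M + b + `|a|) / (gamma^-1 - L)).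
  exists (Num.max r 1) => x; rewrite gt_max => /andP[rx x1] Dx.
  have := rM _ rx Dx; rewrite mulrAC ler_pdivrMr// => Hx.
  have := Vab _ Dx; have := ler_wpM2l (normr_ge0 a) (ltW x1).
  have := ler_norm (- a); rewrite normrN GE; lra.
Qed.

End Legendre.

(* [(L%:E)^-1] is +oo when L = 0. In [%dE], +oo - oo = +oo (it is -oo in [%E]).
   The two convexity premises on [edom h]
   (and not only on its interior) are needed for the first conclusion: f is
   otherwise unconstrained, except from below, at the boundary of [edom h]. *)
Theorem theorem4p1 (R : realType) (n : nat)
    (h f g : 'rV[R]_n -> \bar R) (L : R) :
  legendre h -> rel_smooth L h f -> proper_fun g -> lower_semicontinuous g ->
  let phi := (fun z => f z + g z)%E in
  forall gamma : R, 0 < gamma -> (gamma%:E < L%:E^-1)%E ->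
  let hhat : 'rV[R]_n -> \bar R := (fun x => gamma^-1%:E * h x - f x)%dE in
  let hgf : 'rV[R]_n -> \bar R := (fun x => h x - gamma%:E * f x)%dE in
  [/\ convex_on (edom h) (fun x => L%:E * h x + f x)%E ->
      convex_on (edom h) (fun x => L%:E * h x - f x)%E ->
      legendre hhat,
      forall z x : 'rV[R]_n, (edom h)° x ->
        (phi z + bregman hhat z x =
         f x + (inner (grad f x) (z - x)%R)%:E + g z
           + gamma^-1%:E * bregman h z x)%E &
      forall x : 'rV[R]_n, (edom h)° x ->
        [/\ fb_map f g h gamma x = prox hhat 1 phi x,
            prox hhat 1 phi x = prox hgf gamma phi x &
            fb_envelope f g h gamma x = envelope hhat 1 phi x]].
Proof.
move=> lh sf pg lg phi gamma gamma0 gammaL hhat hgf.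
have idE z x : (edom h)° x -> (phi z + bregman hhat z x =
    f x + (inner (grad f x) (z - x)%R)%:E + g z + gamma^-1%:E * bregman h z x)%E.
  by move=> Dx; exact: (fb_identity lh sf gamma0 z pg Dx).
(* The two objectives agree as functions of [z], hence so do their minimizers and infima. *)
have modelE x : (edom h)° x -> fb_model f g h gamma x =
    (fun z => phi z + 1^-1%:E * bregman hhat z x)%E.
  by move=> Dx; apply/funext => z; rewrite invr1 mul1e idE.
split; [exact: (scaled_sub_legendre lh sf gamma0 gammaL)|exact: idE|move=> x Dx].
split; first by rewrite /fb_map (modelE _ Dx).
  rewrite /prox; congr argmin; apply/funext => z.
  by rewrite invr1 mul1e (sub_scaled_bregman lh sf gamma0 z Dx).
by rewrite /fb_envelope (modelE _ Dx).
Qed.
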